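(* Let $\mathcal{X}$ be a uniformly disconnected metric space. Then $\operatorname{LCJ}(\mathcal{X})>0$.
   Context: For a metric space $\mathcal{X}=(\mathcal{X},\rho)$, $B_r(x)$ denotes the closed ball with center $x\in\mathcal{X}$ and radius $r>0$. The space $\mathcal{X}$ is called uniformly disconnected if there is a constant $c>0$ such that for each $x\in\mathcal{X}$ and $r>0$ there is a closed set $A$ with $B_{cr}(x)\subset A\subset B_r(x)$ and $\operatorname{dist}(A,\mathcal{X}\setminus A)\ge cr$, where $\operatorname{dist}(A,B)=\inf\{\rho(u,v)\mid u\in A,\ v\in B\}$ (equal to $+\infty$ if $B=\emptyset$). Let $a<b$ be real numbers. For a map $\gamma\colon[a,b]\to\mathcal{X}$ (no continuity assumed) set $$\operatorname{V}_\gamma=\sup\sum_{i=1}^N\rho(\gamma(t_{i-1}),\gamma(t_i)),$$ the supremum being over all finite tuples $a=t_0<t_1<\dots<t_N=b$. Write $\gamma\in\operatorname{BV}([a,b],\mathcal{X})$ if $\operatorname{V}_\gamma<\infty$. For $f\colon\mathcal{X}\to\mathbb{R}$ let $L_f=\sup_{x_1\neq x_2}|f(x_1)-f(x_2)|/\rho(x_1,x_2)$ be its global Lipschitz constant, and set $$\operatorname{LV}_\gamma=\sup\{\operatorname{V}_{f\circ\gamma} \mid f\colon\mathcal{X}\to\mathbb{R},\ L_f\le 1\}.$$ Define $$\operatorname{LCJ}(\mathcal{X})=\inf\left\{\frac{\operatorname{LV}_\gamma}{\operatorname{V}_\gamma}\ \Big|\ \gamma\in\operatorname{BV}([a,b],\mathcal{X})\right\},$$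 the quotient being considered only for $\gamma$ with $\operatorname{V}_\gamma>0$ (with the convention $\inf\emptyset=+\infty$). *)

(* Defs.v *)
From mathcomp Require Import all_boot all_order all_algebra.
From mathcomp Require Import all_classical all_reals all_analysis.

Set Implicit Arguments.
Unset Strict Implicit.
Unset Printing Implicit Defensive.

Import Order.TTheory GRing.Theory Num.Theory.
Import numFieldNormedType.Exports.

Local Open Scope classical_set_scope.
Local Open Scope ring_scope.

(* Not the library's [closed_ball], which is the closure of the open ball and
   can be strictly smaller in a general metric space. *)
Definition cball (R : realType) (X : metricType R) (x : X) (r : R) : set X :=
  [set y | mdist x y <= r].

Definition set_dist (R : realType) (X : metricType R) (A B : set X) : \bar R :=
  ereal_inf [set (mdist u v)%:E | u in A & v in B].

Definition uniformly_disconnected (R : realType) (X : metricType R) : Prop :=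
  exists2 c : R, 0 < c &
    forall (x : X) (r : R), 0 < r ->
      exists A : set X,
        [/\ closed A, cball x (c * r) `<=` A, A `<=` cball x r &
            ((c * r)%:E <= set_dist A (~` A))%E].

(* As in [variation] and [total_variation], a map on [a, b] is represented by a
   map on R of which only the values on [a, b] matter, and the subdivision
   a = t_0 < t_1 < ... < t_N = b by the sequence s = [:: t_1; ...; t_N]. *)
Definition mvariation (R : realType) (X : metricType R) (a b : R)
    (g : R -> X) (s : seq R) : R :=
  let t := nth b (a :: s) in
  \sum_(0 <= i < size s) mdist (g (t i)) (g (t i.+1)).

Definition total_mvariation (R : realType) (X : metricType R) (a b : R)
    (g : R -> X) : \bar R :=
  ereal_sup [set (mvariation a b g s)%:E | s in itv_partition a b].

Lemma total_mvariation_real (R : realType) (a b : R) (f : R -> R) :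
  @total_mvariation R R^o a b f = total_variation a b f.
Proof. by rewrite /total_variation /variations image_comp. Qed.

Definition BV (R : realType) (X : metricType R) (a b : R) : set (R -> X) :=
  [set g | (total_mvariation a b g < +oo)%E].

(* When X has at most one point the supremum is over the empty set and has the
   value -oo; the condition L_f <= 1 then holds, as it should. *)
Definition lipschitz_const (R : realType) (X : metricType R) (f : X -> R) :
    \bar R :=
  ereal_sup [set (`|f p.1 - f p.2| / mdist p.1 p.2)%:E |
             p in [set p : X * X | p.1 != p.2]].

(* R^o is R with its usual metric. *)
Definition LV (R : realType) (X : metricType R) (a b : R) (g : R -> X) :
    \bar R :=
  ereal_sup [set @total_mvariation R R^o a b (f \o g) |
             f in [set f : X -> R | (lipschitz_const f <= 1)%E]].

Definition LCJ (R : realType) (X : metricType R) (a b : R) : \bar R :=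
  ereal_inf [set (LV a b g / total_mvariation a b g)%E |
             g in [set g : R -> X | BV a b g /\ (0 < total_mvariation a b g)%E]].

Arguments LCJ {R} X a b.
Arguments uniformly_disconnected {R} X.

(* Main.v *)
(* Given c > 0 from uniform disconnectedness, cut X at each scale d into pieces
   by the sets A with dist(A, X \ A) >= d: points closer than d lie in the same
   piece, points farther apart than d / c in different ones. Let f be the sum
   over dyadic scales d = D / 2 ^ k and over pieces C of +d or -d on C.
   Whatever the signs, |f x - f y| is at most the sum of 2 d over the scales
   d <= rho(x, y), hence at most 4 rho(x, y). For independent random signs, the
   expectation of |f x - f y| is at least the largest single contribution, hence
   at least c rho(x, y) / 2. Averaging over the steps of a subdivision gives
   signs for which f / 4 retains the fraction c / 8 of the variation. *)

Require Import Defs.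
From mathcomp Require Import all_boot all_order all_algebra.
From mathcomp Require Import all_classical all_reals all_analysis.
From mathcomp Require Import ring lra.

Set Implicit Arguments.
Unset Strict Implicit.
Unset Printing Implicit Defensive.

Import Order.TTheory GRing.Theory Num.Theory.

Local Open Scope classical_set_scope.
Local Open Scope ring_scope.

Section sign_average.
Variable R : realFieldType.
Implicit Types (u v w : R) (vs : seq R).

(* The average of `|u + \sum_j e_j v_j| over all choices of signs e_j. *)
Fixpoint sign_avg vs u : R :=
  if vs is v :: vs' then (sign_avg vs' (u + v) + sign_avg vs' (u - v)) / 2
  else `|u|.

Lemma sign_avg_ge_norm vs u : `|u| <= sign_avg vs u.
Proof.
elim: vs u => [|v vs IH] u //=.
have h1 := IH (u + v); have h2 := IH (u - v).
have : `|u *+ 2| <= `|u + v| + `|u - v|.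
  by have := ler_normD (u + v) (u - v); rewrite addrACA subrr addr0 -mulr2n.
rewrite normrMn; lra.
Qed.

(** The two signs of the chosen term give [|u + v| + |u - v| >= 2 |v|], and averaging over the later
    signs never falls below the norm. *)
Lemma sign_avg_ge_mem vs u v : v \in vs -> `|v| <= sign_avg vs u.
Proof.
elim: vs u => [|w vs IH] u //=; rewrite inE => /predU1P[->|vvs].
  have h1 := sign_avg_ge_norm vs (u + w); have h2 := sign_avg_ge_norm vs (u - w).
  have : `|w *+ 2| <= `|u + w| + `|u - w|.
    have := ler_normB (u + w) (u - w).
    by rewrite (_ : u + w - (u - w) = w *+ 2) //; ring.
  rewrite normrMn; lra.
have h1 := IH (u + w) vvs; have h2 := IH (u - w) vvs; lra.
Qed.

Variables (T I : Type) (s : seq I) (p q : I -> T).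

(** Derandomization: signs are fixed one at a time, keeping the branch with the larger sum, since
    the average is the mean of two. [u] accumulates the terms already signed. *)
Lemma sign_choice (hs : seq (T -> R)) (u : T -> R) : exists f : T -> R,
  (forall x y, `|f x - f y - (u x - u y)| <= \sum_(h <- hs) `|h x - h y|) /\
  \sum_(i <- s) sign_avg [seq h (p i) - h (q i) | h <- hs] (u (p i) - u (q i))
    <= \sum_(i <- s) `|f (p i) - f (q i)|.
Proof.
elim: hs u => [|h hs IH] u /=.
  by exists u; split=> [x y|]; rewrite ?subrr ?normr0 ?big_nil.
have [f1 [f1L f1S]] := IH (u \+ h); have [f2 [f2L f2S]] := IH (u \- h).
set S := \sum_(i <- s) _.
have SE : S = (\sum_(i <- s) sign_avg [seq h (p i) - h (q i) | h <- hs]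
                 ((u \+ h) (p i) - (u \+ h) (q i)) +
               \sum_(i <- s) sign_avg [seq h (p i) - h (q i) | h <- hs]
                 ((u \- h) (p i) - (u \- h) (q i))) / 2.
  rewrite -big_split /= mulr_suml; apply: eq_bigr => i _.
  congr ((sign_avg _ _ + sign_avg _ _) / 2); ring.
have [le12|lt12] := leP (\sum_(i <- s) `|f1 (p i) - f1 (q i)|)
                        (\sum_(i <- s) `|f2 (p i) - f2 (q i)|).
- exists f2; split=> [x y|]; last by lra.
  rewrite big_cons (_ : f2 x - f2 y - (u x - u y) =
    - (h x - h y) + (f2 x - f2 y - ((u \- h) x - (u \- h) y))) /=; last by ring.
  by apply: (le_trans (ler_normD _ _)); rewrite normrN lerD2l; exact: f2L.
- exists f1; split=> [x y|]; last by lra.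
  rewrite big_cons (_ : f1 x - f1 y - (u x - u y) =
    (h x - h y) + (f1 x - f1 y - ((u \+ h) x - (u \+ h) y))) /=; last by ring.
  by apply: (le_trans (ler_normD _ _)); rewrite lerD2l; exact: f1L.
Qed.

End sign_average.

Section dyadic_scales.
Variable R : realType.
Implicit Types (D r : R).

(** A geometric series. The bound [2 * r] alone would not survive the induction, which halves [D];
    the minimum with [D] does. *)
Lemma sum_dyadic_le n D r : 0 <= D -> 0 <= r ->
  \sum_(k < n) (if D / 2 ^+ k <= r then D / 2 ^+ k else 0)
    <= 2 * Num.min D r.
Proof.
move=> + r0; elim: n D => [|n IH] D D0.
  by rewrite big_ord0 mulr_ge0 // le_min D0.
rewrite big_ord_recl expr0 divr1.
have /IH : 0 <= D / 2 by lra.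
rewrite (eq_bigr (fun k : 'I_n => if D / 2 ^+ (lift ord0 k) <= r
  then D / 2 ^+ (lift ord0 k) else 0)) => [|k _]; last first.
  by rewrite lift0 exprS invfM mulrA.
rewrite !minElt; case: ifP; case: ifP; case: ifP; lra.
Qed.

Lemma dyadic_scale D r : 0 < r -> r <= D ->
  exists k, r / 2 <= D / 2 ^+ k < r.
Proof.
move=> r0 rD.
have ex : exists k, D / 2 ^+ k < r.
  exists (Num.bound (D / r)); rewrite ltr_pdivrMr ?exprn_gt0 //.
  by rewrite mulrC -ltr_pdivrMr // upper_nthrootP.
(* [r <= D] rules out [k = 0], so the scale just before the first one below [r] exists and is at
   least [r]. *)
case: (ex_minnP ex) => -[|k]; first by rewrite expr0 divr1 ltNge rD.
move=> lt_k min_k; exists k.+1; rewrite lt_k andbT.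
have : ~~ (D / 2 ^+ k < r) by apply/negP => /min_k; rewrite ltnn.
by rewrite -leNgt exprSr invfM mulrA ler_pM2r // invr_gt0.
Qed.

End dyadic_scales.

(** Each of [x] and [y] has one label, occurring at most once in [cs], so each contributes at most
    [d]. *)
Lemma level_variation (R : realDomainType) (T : Type) (C : eqType)
    (l : T -> C) (d : R) (cs : seq C) (x y : T) : 0 <= d -> uniq cs ->
  \sum_(c <- cs) `|d * (l x == c)%:R - d * (l y == c)%:R|
    <= if l x == l y then 0 else 2 * d.
Proof.
move=> d0 ucs; have [->|_] := eqVneq (l x) (l y).
  by rewrite big1 // => c _; rewrite subrr normr0.
have bound z : \sum_(c <- cs) d * (z == c)%:R <= d.
  rewrite -mulr_sumr -natr_sum ler_piMr // (_ : 1 = 1%:R) // ler_nat.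
  rewrite (eq_bigr (fun c => nat_of_bool (pred1 z c))) => [|c _]; last first.
    by rewrite /= eq_sym.
  by rewrite -big_mkcond sum1_count count_uniq_mem // leq_b1.
apply: (@le_trans _ _ (\sum_(c <- cs) (d * (l x == c)%:R + d * (l y == c)%:R))).
  apply: ler_sum => c _; apply: (le_trans (ler_normB _ _)).
  by rewrite !ger0_norm // mulr_ge0.
rewrite big_split /= mulr_natl mulr2n; exact: lerD.
Qed.

Section separated_sets.
Variables (R : realType) (X : metricType R).
Implicit Types (x y : X) (d : R).

Definition separated d (A : set X) :=
  forall u v, A u -> ~ A v -> d <= mdist u v.

(* Points lie in the same separated sets exactly when they have the same
   signature, so [signature d] labels the pieces of [X] at scale [d]. *)
Definition signature d x : set (set X) := [set A | separated d A /\ A x].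

Lemma signature_near d x y : mdist x y < d -> signature d x = signature d y.
Proof.
move=> xyd; apply/seteqP; split=> A [sA Ax]; split=> //; apply: contrapT => nA.
  by have := sA _ _ Ax nA; rewrite leNgt xyd.
by have := sA _ _ Ax nA; rewrite metric_sym leNgt xyd.
Qed.

Lemma signature_far (c : R) :
  (forall x r, 0 < r -> exists A : set X,
    [/\ closed A, cball x (c * r) `<=` A, A `<=` cball x r &
        ((c * r)%:E <= set_dist A (~` A))%E]) -> 0 < c ->
  forall d x y, 0 < d -> d < c * mdist x y -> signature d x <> signature d y.
Proof.
move=> hX c0 d x y d0 dxy sxy.
(* With radius [d / c] the inner ball and the gap of [A] have size [d], while [y] lies outside the
   outer ball. *)
have r0 : 0 < d / c by rewrite divr_gt0.
have [A [_ cA Ac dA]] := hX x _ r0.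
have cE : c * (d / c) = d by rewrite mulrC divfK // gt_eqF.
rewrite cE in cA dA.
have : signature d x A.
  split; last by apply: cA; rewrite /cball /= mdistxx ltW.
  move=> u v Au nAv; rewrite -lee_fin; apply: (le_trans dA).
  by apply: ereal_inf_lbound; exists u => //; exists v.
rewrite sxy => -[_ /Ac]; rewrite /cball /= leNgt ltr_pdivrMr // mulrC.
by rewrite dxy.
Qed.

End separated_sets.

Lemma lipschitz_const_le1 (R : realType) (X : metricType R) (f : X -> R) :
  (forall x y, `|f x - f y| <= mdist x y) -> (lipschitz_const f <= 1)%E.
Proof.
move=> fL; apply: ge_ereal_sup => _ [[x y] /= xy <-].
by rewrite lee_fin ler_pdivrMr ?mul1r ?mdist_gt0.
Qed.

Lemma lipschitz_variation (R : realType) (X : metricType R) (c : R)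
    (N : nat) (p q : nat -> X) : 0 < c ->
  (forall (d : R) x y, 0 < d -> d < c * mdist x y ->
    signature d x <> signature d y :> set (set X)) ->
  exists f : X -> R, (forall x y, `|f x - f y| <= mdist x y) /\
    c / 8 * \sum_(0 <= i < N) mdist (p i) (q i)
      <= \sum_(0 <= i < N) `|f (p i) - f (q i)|.
Proof.
move=> c0 far; pose r i := c * mdist (p i) (q i).
have r_ge0 i : 0 <= r i by rewrite mulr_ge0 ?mdist_ge0 // ltW.
(* Any common upper bound of the [r i] would serve as the top scale. *)
pose D := \sum_(0 <= i < N) r i.
have D0 : 0 <= D by exact: sumr_ge0.
pose d k := D / 2 ^+ k.
have d_ge0 k : 0 <= d k by rewrite divr_ge0 // exprn_ge0.
have scale i : exists k, (i < N)%N -> 0 < r i -> r i / 2 <= d k < r i.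
  have [ri0|] := ltP 0 (r i); last by exists 0%N.
  have [iN|] := ltnP i N; last by exists 0%N.
  have rD : r i <= D.
    rewrite /D big_mkord (bigD1 (Ordinal iN)) //= lerDl.
    exact: sumr_ge0.
  by have [k hk] := dyadic_scale ri0 rD; exists k.
have {scale}[k hk] := choice scale.
pose n := (\max_(i < N) k i).+1.
(* Finitely many pieces suffice: the indicator of the piece of [p i] already tells [p i] from
   [q i]. *)
pose cs j := undup [seq signature (d j) (p i) | i <- index_iota 0 N].
pose h j C (x : X) := d j * (signature (d j) x == C)%:R.
pose hs := [seq h j C | j <- index_iota 0 n, C <- cs j].
have [f [fL fS]] := sign_choice (index_iota 0 N) p q hs (fun=> 0).
exists (fun x => f x / 4); split=> [x y|].
  rewrite -mulrBl normrM [X in _ * X]ger0_norm ?invr_ge0 // ler_pdivrMr //.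
  have := fL x y; rewrite !subr0 => /le_trans; apply.
  rewrite big_allpairs_dep /= big_mkord.
  (* Scales above [mdist x y] contribute nothing. One factor 2 comes from the two pieces, another
     from the geometric series; hence the division by 4. *)
  apply: (@le_trans _ _ (\sum_(j < n)
      2 * (if d j <= mdist x y then d j else 0))).
    apply: ler_sum => j _; apply: le_trans.
      by apply: level_variation; rewrite ?undup_uniq.
    have [_|/signature_near ->] := leP (d j) (mdist x y).
      by case: ifP; rewrite ?mulr_ge0.
    by rewrite eqxx mulr0.
  rewrite -mulr_sumr.
  have := sum_dyadic_le n D0 (mdist_ge0 x y).
  have : Num.min D (mdist x y) <= mdist x y by rewrite ge_min lexx orbT.
  rewrite /d; lra.
rewrite [X in _ <= X](eq_bigr (fun i => `|f (p i) - f (q i)| / 4)); last first.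
  by move=> i _ /=; rewrite -mulrBl normrM [X in _ * X]ger0_norm ?invr_ge0.
rewrite -mulr_suml ler_pdivlMr //; apply: le_trans fS.
rewrite mulrAC mulr_sumr big_nat [X in _ <= X]big_nat.
apply: ler_sum => i /= iN; rewrite subr0.
have [ri0|] := ltP 0 (r i); last first.
  move=> ri0; apply: le_trans (sign_avg_ge_norm _ _).
  by rewrite normr0; rewrite /r in ri0; lra.
have /andP[kle klt] := hk i iN ri0.
have dk0 : 0 < d (k i) by lra.
have hmem : h (k i) (signature (d (k i)) (p i)) \in hs.
  apply/allpairsPdep; exists (k i), (signature (d (k i)) (p i)); split=> //.
    by rewrite mem_index_iota ltnS (leq_bigmax (Ordinal iN)).
  rewrite mem_undup; apply: (map_f (fun i => signature (d (k _)) (p i))).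
  by rewrite mem_index_iota.
(* This single term changes by exactly [d (k i) >= r i / 2] between [p i] and [q i]. *)
apply: le_trans (sign_avg_ge_mem _ _); last first.
  by apply: (map_f (fun g : X -> R => g (p i) - g (q i))); exact: hmem.
rewrite /h eqxx; have /eqP := far _ _ _ dk0 klt.
rewrite eq_sym => /negbTE ->.
rewrite mulr1 mulr0 subr0 ger0_norm //.
rewrite /r in kle; lra.
Qed.

Theorem theorem1p5 (R : realType) (X : metricType R) (a b : R) (hab : a < b)
    (hX : uniformly_disconnected X) :
  (0 < LCJ X a b)%E.
Proof.
have [c c0 hc] := hX.
have c8 : 0 < c / 8 by rewrite divr_gt0.
apply: (@lt_le_trans _ _ (c / 8)%:E); first by rewrite lte_fin.
apply: le_ereal_inf_tmp => _ [g [gBV gpos] <-].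
have Vfin : total_mvariation a b g \is a fin_num.
  by rewrite fin_numE gt_eqF ?lt_eqF // (lt_trans _ gpos) // ltNyr.
have vE := fineK Vfin; set v := fine _ in vE.
have v0 : 0 < v by rewrite -lte_fin vE.
rewrite -vE inver gt_eqF // lee_pdivlMr // vE -lee_pdivlMl //.
(* As [LV] is a supremum over [f], each subdivision [s] may use its own [f]. *)
apply: ge_ereal_sup => _ [s sab <-].
rewrite lee_pdivlMl //.
pose t := nth b (a :: s).
have [f [fL fS]] := lipschitz_variation (size s) (fun i => g (t i.+1))
  (fun i => g (t i)) c0 (signature_far hc c0).
apply: (@le_trans _ _ (total_variation a b (f \o g))); last first.
  rewrite -total_mvariation_real; apply: ereal_sup_ubound.
  by exists f => //; exact: lipschitz_const_le1.
apply: (@le_trans _ _ (variation a b (f \o g) s)%:E); last first.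
  by apply: ereal_sup_ubound; exists (variation a b (f \o g) s) => //; exists s.
rewrite -EFinM lee_fin; apply: le_trans fS.
by rewrite ler_pM2l // /mvariation; apply: ler_sum => i _; rewrite metric_sym.
Qed.
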